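(* Let $\mathcal T$ be a theory (set of formulas) and $\Phi$ a formula of $\mathsf{LAEC}$. Then $\mathcal T\vdash_{\mathsf{LAEC}}\Phi$ if and only if $\mathcal T\models_{\mathsf{LAEC}}\Phi$.
   Context: Fix a finite set $V\subseteq[0,1]$ with $0,1\in V$ and an associative, commutative binary operation $\odot$ on $V$ with neutral element $1$, monotone in both arguments. Fix finitely many propositional variables $\phi_1,\dots,\phi_N$. Basic expressions of $\mathsf{LAEC}$ are built from the variables and constants $\bot,\top$ using $\land,\lor,\neg$ and the unary operators $\Diamond^{\leq},\Diamond^{\geq}$; the set of basic expressions is $\mathcal B$. A diamond expression is one of the form $\Diamond^{\leq}\phi$ or $\Diamond^{\geq}\phi$. A graded implication is $\phi\Rightarrow_c\psi$ with $\phi,\psi\in\mathcal B$, $c\in V$. Formulas are built from graded implications with classical $\land,\lor,\neg$ ($\to,\leftrightarrow$ defined classically). A literal is a variable or negated variable; a m.e.c. is a conjunction of literals in which each variable occurs exactly once. Semantics: a similarity space is $(W,S)$, $W\neq\emptyset$, $S\colon W^2\to V$ with $S(u,v)=1$ iff $u=v$, $S$ symmetric, $S(u,w)\geq S(u,v)\odot S(v,w)$. A totally ordered similarity space $(W,S,\leqslant)$ is a finite similarity space with a total order $\leqslant$ such that $u\leqslant v\leqslant w$ implies $\min(S(u,v),S(v,w))\geq S(u,w)$. For $A\subseteq W$: $U_c(A)=\{w:\exists a\in A,\ S(w,a)\geq c\}$, $\Diamond^{\leq}A=\{v:\exists w\in A,\ v\leqslant w\}$, $\Diamond^{\geq}A=\{v:\exists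 w\in A,\ w\leqslant v\}$. An evaluation is a map $e\colon\mathcal B\to\mathcal P(W)$ with $e(\phi\land\psi)=e(\phi)\cap e(\psi)$, $e(\phi\lor\psi)=e(\phi)\cup e(\psi)$, $e(\neg\phi)=W\setminus e(\phi)$, $e(\bot)=\emptyset$, $e(\top)=W$, $e(\Diamond^{\leq}\phi)=\Diamond^{\leq}e(\phi)$, $e(\Diamond^{\geq}\phi)=\Diamond^{\geq}e(\phi)$, and such that for any distinct $v,w\in W$ some variable $\phi$ has $e(\phi)$ containing exactly one of $v,w$. $e$ satisfies $\phi\Rightarrow_c\psi$ iff $e(\phi)\subseteq U_c(e(\psi))$; satisfaction of compound formulas is classical. $\mathcal T\models_{\mathsf{LAEC}}\Phi$ means: for every totally ordered similarity space and every evaluation in it satisfying all members of $\mathcal T$, $\Phi$ is satisfied. Proof system: $\mathcal T\vdash_{\mathsf{LAEC}}\Phi$ means $\Phi$ is derivable from $\mathcal T$ and the following axioms (for all $\phi,\psi,\chi\in\mathcal B$, $c,d\in V$) by modus ponens: (A1') $\phi\Rightarrow_1\psi$ whenever $\phi,\psi$ arise from classical formulas $\phi',\psi'$ with $\phi'\to\psi'$ a classical tautology by uniform replacement of variables by basic expressions; (A2) $(\phi\Rightarrow_1\psi)\to(\phi\land\neg\psi\Rightarrow_1\bot)$; (A3) $(\phi\Rightarrow_c\psi)\to(\phi\Rightarrow_d\psi)$, $d\leq c$; (A4) $\neg(\psi\Rightarrow_1\bot)\to(\phi\Rightarrow_0\psi)$; (A5) $(\phi\Rightarrow_c\bot)\to(\phi\Rightarrow_1\bot)$;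 (A6) $\neg(\delta\Rightarrow_1\bot)\land(\delta\Rightarrow_c\epsilon)\to(\epsilon\Rightarrow_c\delta)$, $\delta,\epsilon$ m.e.c.'s; (A7) $(\phi\Rightarrow_c\chi)\land(\psi\Rightarrow_c\chi)\to(\phi\lor\psi\Rightarrow_c\chi)$; (A8) $(\epsilon\Rightarrow_c\phi\lor\psi)\to(\epsilon\Rightarrow_c\phi)\lor(\epsilon\Rightarrow_c\psi)$, $\epsilon$ a m.e.c.; (A9) $(\phi\Rightarrow_c\psi)\land(\psi\Rightarrow_d\chi)\to(\phi\Rightarrow_{c\odot d}\chi)$; (A10) $\neg(\top\Rightarrow_1\bot)$; (A11) all formulas obtained from classical tautologies by uniformly replacing variables by graded implications; (A12) $\phi\Rightarrow_1\Diamond^{\leq}\phi$, $\phi\Rightarrow_1\Diamond^{\geq}\phi$; (A13) $\Diamond^{\leq}\Diamond^{\leq}\phi\Rightarrow_1\Diamond^{\leq}\phi$, $\Diamond^{\geq}\Diamond^{\geq}\phi\Rightarrow_1\Diamond^{\geq}\phi$; (A14) $\Diamond^{\leq}\bot\Rightarrow_1\bot$, $\Diamond^{\geq}\bot\Rightarrow_1\bot$; (A15) $(\Diamond^{\leq}\phi\Rightarrow_1\Diamond^{\leq}\psi)\lor(\Diamond^{\leq}\psi\Rightarrow_1\Diamond^{\leq}\phi)$ and likewise for $\Diamond^{\geq}$; (A16) $\Diamond^{\leq}\epsilon\land\Diamond^{\geq}\epsilon\Rightarrow_1\epsilon$, $\epsilon$ a m.e.c.; (A17) $(\phi\Rightarrow_c\psi)\to(\Diamond^{\leq}\phi\Rightarrow_c\Diamond^{\leq}\psi)$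 and likewise for $\Diamond^{\geq}$; (A18) $(\phi\land\Diamond^{\leq}\psi\Rightarrow_1\bot)\to(\Diamond^{\geq}\phi\land\Diamond^{\leq}\psi\Rightarrow_1\bot)$ and $(\phi\land\Diamond^{\geq}\psi\Rightarrow_1\bot)\to(\Diamond^{\leq}\phi\land\Diamond^{\geq}\psi\Rightarrow_1\bot)$; (A19) $\neg(\rho\land\sigma\Rightarrow_1\bot)\land(\phi\Rightarrow_c\rho)\land(\phi\Rightarrow_c\sigma)\to(\phi\Rightarrow_c\rho\land\sigma)$, $\rho,\sigma$ conjunctions of diamond expressions. *)

(* Defs.v *)
From mathcomp Require Import all_boot all_order all_algebra finmap reals.
Set Implicit Arguments.
Unset Strict Implicit.
Unset Printing Implicit Defensive.
Import Order.TTheory GRing.Theory Num.Theory.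
Local Open Scope ring_scope.

Record grading (R : realType) := Grading {
  gset :> {fset R};
  gset_01 : forall c : R, c \in gset -> 0 <= c <= 1;
  gset0 : 0 \in gset;
  gset1 : 1 \in gset;
  godot : gset -> gset -> gset;
  godotA : associative godot;
  godotC : commutative godot;
  godot1 : left_id [` gset1]%fset godot;
  godot_mono : forall a a' b b' : gset,
    \val a <= \val a' -> \val b <= \val b' ->
    \val (godot a b) <= \val (godot a' b') }.

Definition grade (R : realType) (V : grading R) : Type := gset V.
Definition g0 (R : realType) (V : grading R) : grade V := [` gset0 V]%fset.
Definition g1 (R : realType) (V : grading R) : grade V := [` gset1 V]%fset.
Definition odot (R : realType) (V : grading R) : grade V -> grade V -> grade V :=
  @godot R V.
Definition gle (R : realType) (V : grading R) (c d : grade V) : bool :=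
  \val c <= \val d.
Arguments g0 {R V}.
Arguments g1 {R V}.

Inductive bexp (N : nat) : Type :=
| BVar of 'I_N
| BBot
| BTop
| BAnd of bexp N & bexp N
| BOr of bexp N & bexp N
| BNeg of bexp N
| DiaLe of bexp N
| DiaGe of bexp N.
Arguments BBot {N}.
Arguments BTop {N}.

(* Boolean combinations, without constants, of atoms in A. *)
Inductive cform (A : Type) : Type :=
| CAtom of A
| CAnd of cform A & cform A
| COr of cform A & cform A
| CNeg of cform A.

Definition CImp (A : Type) (p q : cform A) : cform A := COr (CNeg p) q.

Fixpoint ceval (A : Type) (v : A -> bool) (p : cform A) : bool :=
  match p with
  | CAtom a => v a
  | CAnd q r => ceval v q && ceval v r
  | COr q r => ceval v q || ceval v r
  | CNeg q => ~~ ceval v q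
  end.

Fixpoint cmap (A B : Type) (f : A -> B) (p : cform A) : cform B :=
  match p with
  | CAtom a => CAtom (f a)
  | CAnd q r => CAnd (cmap f q) (cmap f r)
  | COr q r => COr (cmap f q) (cmap f r)
  | CNeg q => CNeg (cmap f q)
  end.

Definition tautology (p : cform nat) : Prop := forall v : nat -> bool, ceval v p.

(* Classical formulas with constants: the atom [inl n] is the n-th variable,
   [inr true] is the constant top and [inr false] the constant bottom. *)
Definition cform_const : Type := cform (nat + bool).

Definition tautology_const (p : cform_const) : Prop :=
  forall v : nat -> bool,
    ceval (fun a => match a with inl n => v n | inr b => b end) p.

Fixpoint bsubst (N : nat) (s : nat -> bexp N) (p : cform_const) : bexp N :=
  match p with
  | CAtom (inl n) => s n
  | CAtom (inr b) => if b then BTop else BBot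
  | CAnd q r => BAnd (bsubst s q) (bsubst s r)
  | COr q r => BOr (bsubst s q) (bsubst s r)
  | CNeg q => BNeg (bsubst s q)
  end.

Inductive gimp (R : realType) (V : grading R) (N : nat) : Type :=
  GImp of bexp N & grade V & bexp N.

Definition formula (R : realType) (V : grading R) (N : nat) : Type :=
  cform (gimp V N).

(* [conj_of s phi]: phi is a conjunction, bracketed in any way, of the members
   of s taken in this order; the empty conjunction is top, which does not occur
   as a conjunct of a longer one. *)
Inductive conj_of (N : nat) : seq (bexp N) -> bexp N -> Prop :=
| conj_nil : conj_of [::] BTop
| conj_one phi : conj_of [:: phi] phi
| conj_cat s t phi psi : s <> [::] -> t <> [::] ->
    conj_of s phi -> conj_of t psi -> conj_of (s ++ t) (BAnd phi psi).

Definition literal (N : nat) (l : 'I_N * bool) : bexp N :=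
  if l.2 then BVar l.1 else BNeg (BVar l.1).

Definition mec (N : nat) (phi : bexp N) : Prop :=
  exists s : seq ('I_N * bool),
    perm_eq [seq l.1 | l <- s] (enum 'I_N) /\ conj_of [seq literal l | l <- s] phi.

Definition is_diamond (N : nat) (phi : bexp N) : bool :=
  match phi with DiaLe _ | DiaGe _ => true | _ => false end.

Definition diamond_conj (N : nat) (phi : bexp N) : Prop :=
  exists s : seq (bexp N), [/\ s <> [::], all (@is_diamond N) s & conj_of s phi].

Declare Scope bexp_scope.
Delimit Scope bexp_scope with bexp.
Notation "p && q" := (BAnd p q) : bexp_scope.
Notation "p || q" := (BOr p q) : bexp_scope.
Notation "~~ p" := (BNeg p) : bexp_scope.

Declare Scope laec_scope.
Delimit Scope laec_scope with laec.
Notation "p && q" := (CAnd p q) : laec_scope.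
Notation "p || q" := (COr p q) : laec_scope.
Notation "~~ p" := (CNeg p) : laec_scope.
Notation "p ==> q" := (CImp p q) : laec_scope.
Notation "phi =>[ c ] psi" := (CAtom (GImp phi%bexp c psi%bexp))
  (at level 70, no associativity, format "phi  =>[ c ]  psi") : laec_scope.

Inductive axiom (R : realType) (V : grading R) (N : nat) : formula V N -> Prop :=
| A1 (p q : cform_const) (s : nat -> bexp N) :
    tautology_const (CImp p q) ->
    axiom (bsubst s p =>[g1] bsubst s q)%laec
| A2 phi psi :
    axiom ((phi =>[g1] psi) ==> (phi && ~~ psi =>[g1] BBot))%laec
| A3 phi psi c d : gle d c ->
    axiom ((phi =>[c] psi) ==> (phi =>[d] psi))%laec
| A4 phi psi :
    axiom (~~ (psi =>[g1] BBot) ==> (phi =>[g0] psi))%laec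
| A5 phi c :
    axiom ((phi =>[c] BBot) ==> (phi =>[g1] BBot))%laec
| A6 delta eps c : mec delta -> mec eps ->
    axiom (~~ (delta =>[g1] BBot) && (delta =>[c] eps) ==> (eps =>[c] delta))%laec
| A7 phi psi chi c :
    axiom ((phi =>[c] chi) && (psi =>[c] chi) ==> (phi || psi =>[c] chi))%laec
| A8 eps phi psi c : mec eps ->
    axiom ((eps =>[c] phi || psi) ==> (eps =>[c] phi) || (eps =>[c] psi))%laec
| A9 phi psi chi c d :
    axiom ((phi =>[c] psi) && (psi =>[d] chi) ==> (phi =>[odot c d] chi))%laec
| A10 :
    axiom (~~ (BTop =>[g1] BBot))%laec
| A11 (p : cform nat) (s : nat -> gimp V N) : tautology p ->
    axiom (cmap s p)
| A12le phi :
    axiom (phi =>[g1] DiaLe phi)%laec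
| A12ge phi :
    axiom (phi =>[g1] DiaGe phi)%laec
| A13le phi :
    axiom (DiaLe (DiaLe phi) =>[g1] DiaLe phi)%laec
| A13ge phi :
    axiom (DiaGe (DiaGe phi) =>[g1] DiaGe phi)%laec
| A14le :
    axiom (DiaLe BBot =>[g1] BBot)%laec
| A14ge :
    axiom (DiaGe BBot =>[g1] BBot)%laec
| A15le phi psi :
    axiom ((DiaLe phi =>[g1] DiaLe psi) || (DiaLe psi =>[g1] DiaLe phi))%laec
| A15ge phi psi :
    axiom ((DiaGe phi =>[g1] DiaGe psi) || (DiaGe psi =>[g1] DiaGe phi))%laec
| A16 eps : mec eps ->
    axiom (DiaLe eps && DiaGe eps =>[g1] eps)%laec
| A17le phi psi c :
    axiom ((phi =>[c] psi) ==> (DiaLe phi =>[c] DiaLe psi))%laec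
| A17ge phi psi c :
    axiom ((phi =>[c] psi) ==> (DiaGe phi =>[c] DiaGe psi))%laec
| A18le phi psi :
    axiom ((phi && DiaLe psi =>[g1] BBot) ==>
           (DiaGe phi && DiaLe psi =>[g1] BBot))%laec
| A18ge phi psi :
    axiom ((phi && DiaGe psi =>[g1] BBot) ==>
           (DiaLe phi && DiaGe psi =>[g1] BBot))%laec
| A19 phi rho sigma c : diamond_conj rho -> diamond_conj sigma ->
    axiom (~~ (rho && sigma =>[g1] BBot) && (phi =>[c] rho) && (phi =>[c] sigma)
             ==> (phi =>[c] rho && sigma))%laec.

Inductive derivable (R : realType) (V : grading R) (N : nat)
    (T : formula V N -> Prop) : formula V N -> Prop :=
| der_hyp Phi : T Phi -> derivable T Phi
| der_ax Phi : axiom Phi -> derivable T Phi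
| der_mp Phi Psi : derivable T Phi -> derivable T (CImp Phi Psi) -> derivable T Psi.

Record similarity_space (R : realType) (V : grading R) (W : Type)
    (S : W -> W -> grade V) : Prop := SimilaritySpace {
  sim_inhabited : inhabited W;
  sim_eq1 : forall u v, S u v = g1 <-> u = v;
  sim_sym : forall u v, S u v = S v u;
  sim_trans : forall u v w, gle (odot (S u v) (S v w)) (S u w) }.

Record to_similarity_space (R : realType) (V : grading R) (W : finType)
    (S : W -> W -> grade V) (le : rel W) : Prop := ToSimilaritySpace {
  to_sim : similarity_space S;
  to_refl : reflexive le;
  to_anti : antisymmetric le;
  to_trans : transitive le;
  to_total : total le;
  to_compat : forall u v w, le u v -> le v w ->
    gle (S u w) (S u v) && gle (S u w) (S v w) }.

Definition nbhd (R : realType) (V : grading R) (W : finType)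
    (S : W -> W -> grade V) (c : grade V) (A : {set W}) : {set W} :=
  [set w | [exists a in A, gle c (S w a)]].

Definition down_set (W : finType) (le : rel W) (A : {set W}) : {set W} :=
  [set v | [exists w in A, le v w]].

Definition up_set (W : finType) (le : rel W) (A : {set W}) : {set W} :=
  [set v | [exists w in A, le w v]].

Record evaluation (N : nat) (W : finType) (le : rel W) (e : bexp N -> {set W})
    : Prop := Evaluation {
  ev_and : forall phi psi, e (BAnd phi psi) = e phi :&: e psi;
  ev_or : forall phi psi, e (BOr phi psi) = e phi :|: e psi;
  ev_neg : forall phi, e (BNeg phi) = ~: e phi;
  ev_bot : e BBot = set0;
  ev_top : e BTop = [set: W];
  ev_le : forall phi, e (DiaLe phi) = down_set le (e phi);
  ev_ge : forall phi, e (DiaGe phi) = up_set le (e phi);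
  ev_sep : forall v w, v != w ->
    exists i : 'I_N, (v \in e (BVar i)) != (w \in e (BVar i)) }.

Definition sat_gimp (R : realType) (V : grading R) (N : nat) (W : finType)
    (S : W -> W -> grade V) (e : bexp N -> {set W}) (g : gimp V N) : bool :=
  let: GImp phi c psi := g in e phi \subset nbhd S c (e psi).

Definition sat (R : realType) (V : grading R) (N : nat) (W : finType)
    (S : W -> W -> grade V) (e : bexp N -> {set W}) (Phi : formula V N) : bool :=
  ceval (sat_gimp S e) Phi.

Definition entails (R : realType) (V : grading R) (N : nat)
    (T : formula V N -> Prop) (Phi : formula V N) : Prop :=
  forall (W : finType) (S : W -> W -> grade V) (le : rel W),
    to_similarity_space S le ->
    forall e : bexp N -> {set W}, evaluation le e ->
      (forall Psi, T Psi -> sat S e Psi) -> sat S e Phi.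

(* Main.v *)
(* Soundness is checked axiom by axiom; for A19, conjunctions of diamond
   expressions denote convex sets of the order.

   For completeness, extend T to a maximal theory that does not derive Phi; it is
   the truth set of a valuation v of the graded implications that validates all
   axioms. The worlds are the m.e.c.s that v does not identify with bottom. By A8
   with c = 1 every m.e.c. decides every basic expression, nested diamonds
   included, so v identifies basic expressions with sets of worlds. Order the
   worlds by eps <= eps' iff eps =>[1] DiaLe eps', and let S(eps, eps') be the
   largest c with eps =>[c] eps'. By A7 and A8 an implication phi =>[c] psi is
   determined by the worlds below phi and psi; A16 and A18 give antisymmetry, A6
   symmetry of S, and A19, applied to the two diamonds of the middle world, whose
   conjunction is that world by A16, the compatibility of S with the order. *)
Require Import Defs.
From HB Require Import structures.
From mathcomp Require Import all_boot all_order all_algebra finmap reals.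
From mathcomp Require boolp classical_sets.
Set Implicit Arguments.
Unset Strict Implicit.
Unset Printing Implicit Defensive.
Import Order.TTheory.

(** * Order and product of grades *)

Section Grades.
Context {R : realType} {V : grading R}.
Implicit Types c d : grade V.

Lemma gle_refl c : gle c c.
Proof. exact: lexx. Qed.

Lemma gle_trans d c c' : gle c d -> gle d c' -> gle c c'.
Proof. exact: le_trans. Qed.

Lemma gle_anti c d : gle c d -> gle d c -> c = d.
Proof. by move=> h1 h2; apply/val_inj/le_anti/andP. Qed.

Lemma g0_le c : gle g0 c.
Proof. by have /andP[] := gset_01 (valP c). Qed.

Lemma le_g1 c : gle c g1.
Proof. by have /andP[] := gset_01 (valP c). Qed.

Lemma odot1g c : odot g1 c = c.
Proof. exact: godot1. Qed.

Lemma odotg1 c : odot c g1 = c.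
Proof. by rewrite -[RHS]odot1g /odot godotC. Qed.

Lemma gle_odot c c' d d' : gle c c' -> gle d d' -> gle (odot c d) (odot c' d').
Proof. exact: godot_mono. Qed.

End Grades.

(** * Soundness in totally ordered similarity spaces *)

Section Soundness.
Context {R : realType} {V : grading R} {N : nat} {W : finType}.
Variables (S : W -> W -> grade V) (le : rel W) (e : bexp N -> {set W}).
Hypotheses (Sle : to_similarity_space S le) (eval_e : evaluation le e).

Let Sim := to_sim Sle.

Lemma sim_refl w : S w w = g1.
Proof. exact/(sim_eq1 Sim). Qed.

Lemma nbhdP c (A : {set W}) w :
  reflect (exists2 a, a \in A & gle c (S w a)) (w \in nbhd S c A).
Proof. by rewrite inE; apply: exists_inP. Qed.

Lemma sub_nbhd c (A : {set W}) : A \subset nbhd S c A.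
Proof.
by apply/subsetP => w Aw; apply/nbhdP; exists w; rewrite ?sim_refl ?le_g1.
Qed.

Lemma nbhd_g1 (A : {set W}) : nbhd S g1 A = A.
Proof.
apply/eqP; rewrite eqEsubset sub_nbhd andbT; apply/subsetP => w /nbhdP[a Aa h].
by have /(sim_eq1 Sim) -> : S w a = g1 by apply: gle_anti; rewrite ?le_g1.
Qed.

Lemma sim_between_l c u v w : le u v -> le v w -> gle c (S u w) -> gle c (S u v).
Proof.
by move=> uv vw /gle_trans; apply; have /andP[] := to_compat Sle uv vw.
Qed.

Lemma sim_between_r c u v w : le u v -> le v w -> gle c (S w u) -> gle c (S w v).
Proof.
rewrite (sim_sym Sim w u) (sim_sym Sim w v) => uv vw /gle_trans; apply.
by have /andP[] := to_compat Sle uv vw.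
Qed.

Lemma down_setP (A : {set W}) v :
  reflect (exists2 w, w \in A & le v w) (v \in down_set le A).
Proof. by rewrite inE; apply: exists_inP. Qed.

Lemma up_setP (A : {set W}) v :
  reflect (exists2 w, w \in A & le w v) (v \in up_set le A).
Proof. by rewrite inE; apply: exists_inP. Qed.

Lemma eval_bsubst (s : nat -> bexp N) (p : cform_const) w :
  (w \in e (bsubst s p))
  = ceval (fun a => match a with inl n => w \in e (s n) | inr b => b end) p.
Proof.
elim: p => [[n|[]]|p IHp q IHq|p IHp q IHq|p IHp] //=.
- by rewrite (ev_top eval_e) inE.
- by rewrite (ev_bot eval_e) inE.
- by rewrite (ev_and eval_e) inE IHp IHq.
- by rewrite (ev_or eval_e) inE IHp IHq.
- by rewrite (ev_neg eval_e) inE IHp.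
Qed.

Lemma eval_conj_literal (l : seq ('I_N * bool)) phi w :
  conj_of [seq literal l | l <- l] phi -> w \in e phi ->
  forall i b, (i, b) \in l -> (w \in e (BVar i)) = b.
Proof.
move: {-1}[seq _ | _ <- _] (erefl [seq literal l | l <- l]) => t Et Ht.
elim: Ht l Et => {t phi} [|phi|s t phi psi _ _ _ IHs _ IHt] l.
- by case: l.
- case: l => [|[i b] [|]] //= [<-]; rewrite /literal /= => h j b'.
  rewrite inE => /eqP[-> ->]; case: b h => //.
  by rewrite (ev_neg eval_e) inE => /negbTE.
- move=> El; rewrite (ev_and eval_e) inE => /andP[hphi hpsi] i b.
  (* The list [l] of signed variables is cut at [size s], where the conjunction splits its list of
     literals. *)
  rewrite -(cat_take_drop (size s) l) mem_cat.
  have Es : [seq literal x | x <- take (size s) l] = s.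
    by rewrite map_take El take_size_cat.
  have Et : [seq literal x | x <- drop (size s) l] = t.
    by rewrite map_drop El drop_size_cat.
  by case/orP; [apply: IHs | apply: IHt].
Qed.

(** Every variable occurs in an m.e.c., so its value is fixed on the denoted set, while distinct
    points are separated by some variable. *)
Lemma eval_mec_inj eps v w : mec eps -> v \in e eps -> w \in e eps -> v = w.
Proof.
case=> l [/perm_mem ml cl] hv hw; apply/eqP; case: eqP => // /eqP.
case/(ev_sep eval_e) => i; have : i \in [seq x.1 | x <- l] by rewrite ml mem_enum.
case/mapP => -[j b] lb /= ->.
by rewrite (eval_conj_literal cl hv lb) (eval_conj_literal cl hw lb) eqxx.
Qed.

Definition convex (A : {set W}) : Prop :=
  forall u v w, u \in A -> w \in A -> le u v -> le v w -> v \in A.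

(** A diamond expression denotes a down-set or an up-set, both convex, and convexity survives
    intersection. *)
Lemma eval_diamond_conj phi : diamond_conj phi -> convex (e phi).
Proof.
case=> s [_ + Hs]; elim: Hs => {s phi} [|phi|s t phi psi _ _ _ IHs _ IHt].
- by rewrite (ev_top eval_e) => _ u v w; rewrite !inE.
- rewrite /= andbT; case: phi => //= phi _ u v w.
  + rewrite (ev_le eval_e) => _ /down_setP[x xA wx] _ vw.
    by apply/down_setP; exists x => //; apply: (to_trans Sle) wx.
  + rewrite (ev_ge eval_e) => /up_setP[x xA xu] _ uv _.
    by apply/up_setP; exists x => //; apply: (to_trans Sle) uv.
- rewrite all_cat => /andP[/IHs cs /IHt ct] u v w; rewrite (ev_and eval_e) !inE.
  move=> /andP[us ut] /andP[ws wt] uv vw.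
  by rewrite (cs _ _ _ us ws uv vw) (ct _ _ _ ut wt uv vw).
Qed.

(* Of two close points, one in each convex set, the one that faces the common
   point [x], or [x] itself, is close as well. *)
Lemma nbhd_convexI c (A B : {set W}) w x :
  convex A -> convex B -> x \in A -> x \in B ->
  w \in nbhd S c A -> w \in nbhd S c B -> w \in nbhd S c (A :&: B).
Proof.
move=> cA cB xA xB /nbhdP[r rA wr] /nbhdP[s sB ws].
suff [y [yA yB wy]] : exists y, [/\ y \in A, y \in B & gle c (S w y)].
  by apply/nbhdP; exists y => //; rewrite inE yA.
have mem_r : le x r -> le r s -> r \in B by apply: cB.
have mem_r' : le s r -> le r x -> r \in B by apply: cB.
have mem_s : le x s -> le s r -> s \in A by apply: cA.
have mem_s' : le r s -> le s x -> s \in A by apply: cA.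
have tot := to_total Sle.
have usex : gle c (S w x) -> exists y, [/\ y \in A, y \in B & gle c (S w y)].
  by exists x.
have user : r \in B -> exists y, [/\ y \in A, y \in B & gle c (S w y)].
  by exists r.
have uses : s \in A -> exists y, [/\ y \in A, y \in B & gle c (S w y)].
  by exists s.
have [xr|rx] := orP (tot x r); have [xs|sx] := orP (tot x s).
- by have [h|h] := orP (tot r s); [apply/user/mem_r | apply/uses/mem_s].
- have [wx|xw] := orP (tot w x).
  + by apply: usex; apply: sim_between_l wr.
  + by apply: usex; apply: sim_between_r ws.
- have [wx|xw] := orP (tot w x).
  + by apply: usex; apply: sim_between_l ws.
  + by apply: usex; apply: sim_between_r wr.
- by have [h|h] := orP (tot r s); [apply/uses/mem_s' | apply/user/mem_r'].
Qed.

(** Semantic core of A18: if a point of [A] lies below [v] and [v] below a point of [B], then by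
    transitivity that point of [A] already lies in the down-set of [B]. *)
Lemma sub_up_down A (B : {set W}) : A :&: down_set le B = set0 ->
  up_set le A :&: down_set le B = set0.
Proof.
move=> h; apply/setP => v; rewrite [RHS]inE inE.
apply/negbTE/negP => /andP[/up_setP[a aA av] /down_setP[b bB vb]].
have: a \in A :&: down_set le B.
  rewrite inE aA; apply/down_setP; exists b => //; exact: to_trans Sle _ _ _ av vb.
by rewrite h inE.
Qed.

Lemma sub_down_up A (B : {set W}) : A :&: up_set le B = set0 ->
  down_set le A :&: up_set le B = set0.
Proof.
move=> h; apply/setP => v; rewrite [RHS]inE inE.
apply/negbTE/negP => /andP[/down_setP[a aA va] /up_setP[b bB bv]].
have: a \in A :&: up_set le B.
  rewrite inE aA; apply/up_setP; exists b => //; exact: to_trans Sle _ _ _ bv va.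
by rewrite h inE.
Qed.

Lemma sat_cmap (s : nat -> gimp V N) p :
  ceval (sat_gimp S e) (cmap s p) = ceval (fun n => sat_gimp S e (s n)) p.
Proof. by elim: p => //= [p -> q ->|p -> q ->|p ->]. Qed.

Lemma sat_axiom (Psi : formula V N) : axiom Psi -> sat S e Psi.
Proof.
(* Nothing is near the empty set, not even at grade [g0]; so an implication into bottom says at
   every grade that its left side is empty. *)
have nbhd0 c : nbhd S c set0 = set0.
  by apply/setP => w; rewrite [RHS]inE; apply/nbhdP => -[a]; rewrite inE.
have bot := ev_bot eval_e.
have nb phi c : (e phi \subset nbhd S c (e BBot)) = (e phi == set0).
  by rewrite bot nbhd0 subset0.
have lerefl := to_refl Sle; have tr := to_trans Sle.
case=> {Psi} [p q s pq|phi psi|phi psi c d dc|phi psi|phi c|delta eps c md me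
  |phi psi chi c|eps phi psi c me|phi psi chi c d||p s tp|phi|phi|phi|phi|||phi psi
  |phi psi|eps me|phi psi c|phi psi c|phi psi|phi psi|phi rho sigma c cr cs];
  rewrite /sat /= -?implybE ?nb ?nbhd_g1.
- apply/subsetP => w; rewrite !eval_bsubst.
  by have := pq (fun n => w \in e (s n)); rewrite /= -implybE => /implyP.
- by apply/implyP; rewrite (ev_and eval_e) (ev_neg eval_e) -setDE setD_eq0.
- apply/implyP => /subsetP h; apply/subsetP => w /h /nbhdP[a aA wa].
  by apply/nbhdP; exists a => //; apply: gle_trans wa.
- apply/implyP => /set0Pn[a aA]; apply/subsetP => w _.
  by apply/nbhdP; exists a => //; apply: g0_le.
- exact: implybb.
- apply/implyP => /andP[/set0Pn[x xd] /subsetP/(_ x xd)/nbhdP[y ye xy]].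
  apply/subsetP => z ze; apply/nbhdP; exists x => //.
  by rewrite (eval_mec_inj me ze ye) (sim_sym Sim).
- by apply/implyP; rewrite (ev_or eval_e) subUset.
(* A8: [eps] denotes at most one point, so the disjunct with a point near it serves all of
   [e eps]. *)
- apply/implyP => /subsetP h; have [->|/set0Pn[x xe]] := eqVneq (e eps) set0.
    by rewrite sub0set.
  have sub1 (A : {set W}) : x \in A -> e eps \subset A.
    by move=> xA; apply/subsetP => z ze; rewrite (eval_mec_inj me ze xe).
  have /nbhdP[y] := h x xe; rewrite (ev_or eval_e) inE => /orP[] yA xy; apply/orP.
    by left; apply: sub1; apply/nbhdP; exists y.
  by right; apply: sub1; apply/nbhdP; exists y.
- apply/implyP => /andP[/subsetP h1 /subsetP h2]; apply/subsetP => u /h1.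
  case/nbhdP=> v /h2 /nbhdP[w wc vw] uv; apply/nbhdP; exists w => //.
  by apply: gle_trans (sim_trans Sim u v w); apply: gle_odot.
- by case: (sim_inhabited Sim) => w; apply/set0Pn; exists w; rewrite (ev_top eval_e) inE.
- by rewrite sat_cmap; apply: tp.
- rewrite (ev_le eval_e); apply/subsetP => w we; apply/down_setP; by exists w.
- rewrite (ev_ge eval_e); apply/subsetP => w we; apply/up_setP; by exists w.
- rewrite !(ev_le eval_e); apply/subsetP => u /down_setP[v /down_setP[w we vw] uv].
  by apply/down_setP; exists w => //; apply: tr vw.
- rewrite !(ev_ge eval_e); apply/subsetP => u /up_setP[v /up_setP[w we wv] vu].
  by apply/up_setP; exists w => //; apply: tr vu.
- rewrite (ev_le eval_e) bot -subset0.
  by apply/subsetP => u /down_setP[v]; rewrite inE.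
- rewrite (ev_ge eval_e) bot -subset0.
  by apply/subsetP => u /up_setP[v]; rewrite inE.
- rewrite !(ev_le eval_e); case: (boolP (_ \subset _)) => //= /subsetPn[v].
  (* A15: [v] is below a point of [phi] but below none of [psi]; by totality all of [psi] lies below
     [v]. *)
  case/down_setP=> a aphi va nv; apply/subsetP => u /down_setP[w wpsi uw].
  have [vw|wv] := orP (to_total Sle v w).
    by case/negP: nv; apply/down_setP; exists w.
  by apply/down_setP; exists a => //; exact: tr uw (tr _ _ _ wv va).
- rewrite !(ev_ge eval_e); case: (boolP (_ \subset _)) => //= /subsetPn[v].
  case/up_setP=> a aphi va nv; apply/subsetP => u /up_setP[w wpsi uw].
  have [vw|wv] := orP (to_total Sle w v).
    by case/negP: nv; apply/up_setP; exists w.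
  by apply/up_setP; exists a => //; exact: tr (tr _ _ _ va wv) uw.
- rewrite (ev_and eval_e) (ev_le eval_e) (ev_ge eval_e); apply/subsetP => v.
  rewrite inE => /andP[/down_setP[a ae va] /up_setP[b be bv]].
  have ba := eval_mec_inj me be ae.
  by rewrite ba in bv; rewrite (@to_anti _ _ _ _ _ Sle v a) ?va ?bv.
- rewrite !(ev_le eval_e); apply/implyP => /subsetP h.
  apply/subsetP => v /down_setP[w /h /nbhdP[x xpsi wx] vw].
  (* A17: either [v] is itself below the point [x] of [psi], or it lies between [x] and [w] and is
     at least as close to [x] as [w] is. *)
  have [vx|xv] := orP (to_total Sle v x).
    by apply: (subsetP (sub_nbhd _ _)); apply/down_setP; exists x.
  apply/nbhdP; exists x; first by apply/down_setP; exists x.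
  by rewrite (sim_sym Sim); apply: (sim_between_l xv vw); rewrite (sim_sym Sim).
- rewrite !(ev_ge eval_e); apply/implyP => /subsetP h.
  apply/subsetP => v /up_setP[w /h /nbhdP[x xpsi wx] wv].
  have [vx|xv] := orP (to_total Sle x v).
    by apply: (subsetP (sub_nbhd _ _)); apply/up_setP; exists x.
  apply/nbhdP; exists x; first by apply/up_setP; exists x.
  by rewrite (sim_sym Sim); apply: (sim_between_r wv xv); rewrite (sim_sym Sim).
- apply/implyP; rewrite !(ev_and eval_e) (ev_le eval_e) (ev_ge eval_e).
  by move/eqP/sub_up_down->.
- apply/implyP; rewrite !(ev_and eval_e) (ev_le eval_e) (ev_ge eval_e).
  by move/eqP/sub_down_up->.
- apply/implyP; rewrite !(ev_and eval_e).
  move=> /andP[/andP[/set0Pn[x] ]]; rewrite inE => /andP[xr xs] /subsetP hr.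
  move=> /subsetP hs; apply/subsetP => w wphi.
  by apply: (@nbhd_convexI _ _ _ w x); auto; apply: eval_diamond_conj.
Qed.

End Soundness.

Lemma derivable_entails (R : realType) (V : grading R) (N : nat)
    (T : formula V N -> Prop) (Phi : formula V N) :
  derivable T Phi -> entails T Phi.
Proof.
move=> D W S le Sle e eval_e hT.
elim: D => {Phi} [Phi /hT //|Phi /(sat_axiom Sle eval_e) //|Phi Psi _ h _].
by rewrite /sat /= -implybE => /implyP; apply.
Qed.

(** * Numbering of basic expressions and propositional skeletons *)

Section Encoding.
Context {N : nat}.

(** A1 and A11 substitute for variables numbered by naturals; the coding as trees makes expressions
    countable and so supplies the numbers. *)
Fixpoint bexp_code (phi : bexp N) : GenTree.tree 'I_N :=
  match phi with
  | BVar i => GenTree.Leaf i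
  | BBot => GenTree.Node 0 [::]
  | BTop => GenTree.Node 1 [::]
  | BAnd p q => GenTree.Node 2 [:: bexp_code p; bexp_code q]
  | BOr p q => GenTree.Node 3 [:: bexp_code p; bexp_code q]
  | BNeg p => GenTree.Node 4 [:: bexp_code p]
  | DiaLe p => GenTree.Node 5 [:: bexp_code p]
  | DiaGe p => GenTree.Node 6 [:: bexp_code p]
  end.

Fixpoint bexp_decode (t : GenTree.tree 'I_N) : bexp N :=
  match t with
  | GenTree.Leaf i => BVar i
  | GenTree.Node 1 _ => BTop
  | GenTree.Node 2 [:: p; q] => BAnd (bexp_decode p) (bexp_decode q)
  | GenTree.Node 3 [:: p; q] => BOr (bexp_decode p) (bexp_decode q)
  | GenTree.Node 4 [:: p] => BNeg (bexp_decode p)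
  | GenTree.Node 5 [:: p] => DiaLe (bexp_decode p)
  | GenTree.Node 6 [:: p] => DiaGe (bexp_decode p)
  (* Covers [BBot] itself, which has tag 0, as well as trees that code nothing. *)
  | _ => BBot
  end.

Lemma bexp_codeK : cancel bexp_code bexp_decode.
Proof.
by elim=> //= [p -> q ->|p -> q ->|p ->|p ->|p ->].
Qed.

HB.instance Definition _ := Countable.copy (bexp N) (can_type bexp_codeK).

(* Truth of [phi] under an assignment of its maximal subexpressions that are
   variables or diamond expressions. *)
Fixpoint beval (a : bexp N -> bool) (phi : bexp N) : bool :=
  match phi with
  | BBot => false
  | BTop => true
  | BAnd p q => beval a p && beval a q
  | BOr p q => beval a p || beval a q
  | BNeg p => ~~ beval a p
  | _ => a phi
  end.

(** The classical formula from which [phi] arises as an instance of A1: its atoms are the codes of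
    the subexpressions that [beval] leaves to the assignment. *)
Fixpoint skeleton (phi : bexp N) : cform_const :=
  match phi with
  | BBot => CAtom (inr false)
  | BTop => CAtom (inr true)
  | BAnd p q => CAnd (skeleton p) (skeleton q)
  | BOr p q => COr (skeleton p) (skeleton q)
  | BNeg p => CNeg (skeleton p)
  | _ => CAtom (inl (choice.pickle phi))
  end.

Definition decode_bexp (n : nat) : bexp N := odflt BTop (choice.unpickle n).

Lemma pickle_bexpK : cancel choice.pickle decode_bexp.
Proof. by move=> phi; rewrite /decode_bexp choice.pickleK. Qed.

Lemma bsubst_skeleton phi : bsubst decode_bexp (skeleton phi) = phi.
Proof.
by elim: phi => /= [i|||p -> q ->|p -> q ->|p ->|p _|p _];
  rewrite ?pickle_bexpK.
Qed.

Lemma ceval_skeleton v phi :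
  ceval (fun a => match a with inl n => v n | inr b => b end) (skeleton phi)
  = beval (v \o choice.pickle) phi.
Proof. by elim: phi => //= [p -> q ->|p -> q ->|p ->]. Qed.

End Encoding.

(** * Classical derivations, maximal theories and valuations *)

Section PropositionalCompleteness.
Context {R : realType} {V : grading R} {N : nat}.
Implicit Types (T : formula V N -> Prop) (Psi : formula V N).

Definition gimp_code (g : gimp V N) : bexp N * gset V * bexp N :=
  let: GImp phi c psi := g in (phi, c, psi).

Definition gimp_decode (t : bexp N * gset V * bexp N) : gimp V N :=
  GImp t.1.1 t.1.2 t.2.

Lemma gimp_codeK : cancel gimp_code gimp_decode.
Proof. by case. Qed.

(** A valuation of the numbered variables pulls back along [pickle] to an assignment, so the
    skeletons form a tautology. *)
Lemma axiom_bexp_taut (phi psi : bexp N) :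
  (forall a, beval a phi -> beval a psi) ->
  axiom (CAtom (GImp phi (@g1 R V) psi)).
Proof.
move=> h; rewrite -(bsubst_skeleton phi) -(bsubst_skeleton psi); apply: A1 => v.
by rewrite /CImp /= !ceval_skeleton -implybE; apply/implyP/h.
Qed.

(** Numbering the graded implications in [Psi] turns it into a tautology over [nat], of which [Psi]
    is an instance by A11. *)
Lemma derivable_taut T Psi : (forall v, ceval v Psi) -> derivable T Psi.
Proof.
move=> h; pose code g := choice.pickle (gimp_code g).
pose s n := if choice.unpickle n is Some t then gimp_decode t else GImp BBot g0 BBot.
have sK g : s (code g) = g by rewrite /s /code choice.pickleK gimp_codeK.
have -> : Psi = cmap s (cmap code Psi).
  by elim: Psi {h} => //= [g|p <- q <-|p <- q <-|p <-] //; rewrite sK.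
apply/der_ax/A11 => v.
suff -> : ceval v (cmap code Psi) = ceval (v \o code) Psi by apply: h.
by elim: Psi {h} => //= [p -> q ->|p -> q ->|p ->].
Qed.

Lemma derivable_mono T T' Psi :
  (forall X, T X -> T' X) -> derivable T Psi -> derivable T' Psi.
Proof.
move=> TT'; elim=> {Psi} [X /TT'|X|X Y _ h1 _ h2].
- exact: der_hyp.
- exact: der_ax.
- exact: der_mp h1 h2.
Qed.

Lemma derivable_taut1 T A B : derivable T A ->
  (forall v, ceval v A -> ceval v B) -> derivable T B.
Proof.
move=> dA h; apply: der_mp dA _; apply: derivable_taut => v.
by rewrite /CImp /= -implybE; apply/implyP/h.
Qed.

Lemma derivable_taut2 T A B C : derivable T A -> derivable T B ->
  (forall v, ceval v A -> ceval v B -> ceval v C) -> derivable T C.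
Proof.
move=> dA dB h; apply: der_mp dB (derivable_taut1 dA _) => v hA.
by rewrite /CImp /= -implybE; apply/implyP/h.
Qed.

Lemma deduction T A B :
  derivable (fun X => T X \/ X = A) B -> derivable T (CImp A B).
Proof.
elim=> {B} [B [TB|->]|B axB|B C _ hB _ hC].
- by apply: derivable_taut1 (der_hyp TB) _ => v; rewrite /CImp /= orbC => ->.
- by apply: derivable_taut => v; rewrite /CImp /= orNb.
- by apply: derivable_taut1 (der_ax _ axB) _ => v; rewrite /CImp /= orbC => ->.
- apply: derivable_taut2 hB hC _ => v; rewrite /CImp /=.
  by case: (ceval v A); case: (ceval v B).
Qed.

Lemma maximal_underivable T Phi : ~ derivable T Phi ->
  exists T', [/\ forall X, T X -> T' X, ~ derivable T' Phi &
    forall X, ~ T' X -> derivable T' (CImp X Phi)].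
Proof.
move=> nPhi; pose P (X : classical_sets.set (formula V N)) :=
  ~ derivable (fun Y => T Y \/ X Y) Phi.
case: (@classical_sets.Zorn_bigcup _ P) => [F FP Ftot|M [PM maxM]].
  (* A derivation uses finitely many hypotheses, so one member of the chain suffices. The first
     alternative covers derivations from [T] alone, hence also the empty chain. *)
  have fin Psi : derivable (fun Y => T Y \/ classical_sets.bigcup F id Y) Psi ->
      derivable T Psi \/ exists2 X, F X & derivable (fun Y => T Y \/ X Y) Psi.
    elim=> {Psi} [X [TX|[Y FY YX]]|X axX|X Y _ IH1 _ IH2].
    - by left; apply: der_hyp.
    - by right; exists Y => //; apply: der_hyp; right.
    - by left; apply: der_ax.
    - case: IH1 IH2 => [d1|[A FA d1]] [d2|[B FB d2]].
      + by left; apply: der_mp d1 d2.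
      + right; exists B => //; apply: der_mp d2; apply: derivable_mono d1.
        by left.
      + right; exists A => //; apply: (der_mp d1); apply: derivable_mono d2.
        by left.
      + case: (Ftot A B FA FB) => sub; right.
        * exists B => //; apply: der_mp d2; apply: derivable_mono d1 => Z.
          by case=> [|/sub]; [left | right].
        * exists A => //; apply: (der_mp d1); apply: derivable_mono d2 => Z.
          by case=> [|/sub]; [left | right].
  by move=> /fin[//|[X /FP PX /PX]].
exists (fun Y => T Y \/ M Y); split=> // [X TX|X nX]; first by left.
apply: deduction; apply: boolp.contrapT => nd.
apply: (maxM (fun Y => M Y \/ Y = X)).
  split=> [Y MY|sub]; first by left.
  by apply: nX; right; apply: sub; right.
by apply: contra_not nd; apply: derivable_mono => Y [|[|]]; auto.
Qed.

(** Truth is derivability from a maximal theory. There [Phi] acts as falsum: exactly one of [X] and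
    [CImp X Phi] is derivable, which yields the clauses for the connectives. *)
Lemma valuation_of_underivable T Phi : ~ derivable T Phi ->
  exists v : gimp V N -> bool,
    [/\ forall X, T X -> ceval v X, forall X, axiom X -> ceval v X &
      ~~ ceval v Phi].
Proof.
case/maximal_underivable=> M [TM nPhi maxM].
have alt X : derivable M X \/ derivable M (CImp X Phi).
  by have [/der_hyp|/maxM] := boolp.EM (M X); [left | right].
have excl X : derivable M X -> derivable M (CImp X Phi) -> False.
  by move=> h1 h2; apply/nPhi/(der_mp h1).
pose v g := boolp.asbool (derivable M (CAtom g)).
suff truth X : ceval v X <-> derivable M X.
  exists v; split=> [X /TM/der_hyp/truth //|X /der_ax h|]; first exact/truth/h.
  by apply/negP => /truth.
elim: X => [g|A IHA B IHB|A IHA B IHB|A IHA] /=.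
- by split=> /boolp.asboolP.
- split=> [/andP[/IHA dA /IHB dB]|d].
    by apply: derivable_taut2 dA dB _ => w /= -> ->.
  by apply/andP; split; [apply/IHA | apply/IHB];
    apply: derivable_taut1 d _ => w /= /andP[].
- split=> [/orP[/IHA d|/IHB d]|d].
  + by apply: derivable_taut1 d _ => w /= ->.
  + by apply: derivable_taut1 d _ => w /= ->; rewrite orbT.
  + case: (alt A) => [/IHA -> //|dA]; case: (alt B) => [/IHB ->|dB].
      by rewrite orbT.
    case: (excl _ d); apply: derivable_taut2 dA dB _ => w.
    by rewrite /CImp /=; case: (ceval w A); case: (ceval w B).
- split=> [/negP nA|d].
    case: (alt A) => [/IHA //|dA]; case: (alt (CNeg A)) => // dnA.
    case: nPhi; apply: derivable_taut2 dA dnA _ => w.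
    by rewrite /CImp /=; case: (ceval w A).
  apply/negP => /IHA dA; apply: nPhi; apply: derivable_taut2 d dA _ => w /=.
  by move/negbTE->.
Qed.

End PropositionalCompleteness.

(** * Calculus of graded implications true under a valuation *)

Section CanonicalModel.
Context {R : realType} {V : grading R} {N : nat}.
Variable v : gimp V N -> bool.
Hypothesis v_axiom : forall X, axiom X -> ceval v X.
Implicit Types (phi psi chi eps : bexp N) (c d : grade V).

Definition gi c phi psi : bool := v (GImp phi c psi).

Let gi_axiom c phi psi : axiom (CAtom (GImp phi c psi)) -> gi c phi psi.
Proof. exact: v_axiom. Qed.

Let v_imp X Y : axiom (CImp X Y) -> ceval v X -> ceval v Y.
Proof. by move/v_axiom; rewrite /CImp /= -implybE => /implyP. Qed.

Let v_imp2 X Y Z : axiom (CImp (CAnd X Y) Z) ->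
  ceval v X -> ceval v Y -> ceval v Z.
Proof. by move=> /v_imp h hX hY; apply: h; rewrite /= hX. Qed.

Lemma gi_taut phi psi :
  (forall a, beval a phi -> beval a psi) -> gi g1 phi psi.
Proof. by move/(@axiom_bexp_taut R V)/v_axiom. Qed.

Lemma gi_trans c d phi psi chi :
  gi c phi psi -> gi d psi chi -> gi (odot c d) phi chi.
Proof. exact: (v_imp2 (A9 _ _ _ _ _)). Qed.

Lemma gi_transl c phi psi chi : gi g1 phi psi -> gi c psi chi -> gi c phi chi.
Proof. by rewrite -{2}[c]odot1g; apply: gi_trans. Qed.

Lemma gi_transr c phi psi chi : gi c phi psi -> gi g1 psi chi -> gi c phi chi.
Proof. by rewrite -{2}[c]odotg1; apply: gi_trans. Qed.

Lemma gi_le c d phi psi : gle d c -> gi c phi psi -> gi d phi psi.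
Proof. by move=> dc; apply: (v_imp (A3 _ _ dc)). Qed.

Lemma gi_orl c phi psi chi :
  gi c phi chi -> gi c psi chi -> gi c (BOr phi psi) chi.
Proof. exact: (v_imp2 (A7 _ _ _ _)). Qed.

(** By A2, [phi] together with [~~ psi] and with [~~ ~~ psi] implies bottom; A7 joins the two cases,
    which exhaust [phi]. *)
Lemma gi_contra phi psi : gi g1 phi psi -> gi g1 phi (BNeg psi) -> gi g1 phi BBot.
Proof.
move=> /(v_imp (A2 _ _ _)) h1 /(v_imp (A2 _ _ _)) h2.
apply: gi_transl (gi_orl h1 h2); apply: gi_taut => a /= ->; exact: orbN.
Qed.

Lemma gi_bot c phi : gi c phi BBot -> gi g1 phi BBot.
Proof. exact: (v_imp (A5 _ _)). Qed.

Lemma gi_mec_or c eps phi psi : mec eps ->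
  gi c eps (BOr phi psi) -> gi c eps phi || gi c eps psi.
Proof. by move=> me; apply: (v_imp (A8 _ _ _ me)). Qed.

(** The last conjunct gets no trailing [BTop], since [conj_of] admits top only as the empty
    conjunction. *)
Fixpoint conjs (s : seq (bexp N)) : bexp N :=
  match s with
  | [::] => BTop
  | [:: phi] => phi
  | phi :: s => BAnd phi (conjs s)
  end.

Lemma conjs_conj_of s : conj_of s (conjs s).
Proof.
elim: s => [|phi [|psi s] IHs]; [exact: conj_nil | exact: conj_one |].
by apply: (@conj_cat _ [:: phi]) => //; apply: conj_one.
Qed.

Lemma beval_conjs a phi s : beval a (conjs (phi :: s)) = beval a phi && beval a (conjs s).
Proof. by case: s => //=; rewrite andbT. Qed.

(** * M.e.c.s and worlds *)

Definition literals (f : 'I_N -> bool) (l : seq 'I_N) : seq (bexp N) :=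
  [seq literal (i, f i) | i <- l].

Definition minterm (f : {ffun 'I_N -> bool}) : bexp N :=
  conjs (literals f (enum 'I_N)).

Lemma minterm_mec f : mec (minterm f).
Proof.
exists [seq (i, f i) | i <- enum 'I_N].
split; last by rewrite -map_comp; apply: conjs_conj_of.
by rewrite -map_comp (eq_map (g := id)) // map_id.
Qed.

Lemma minterm_literal f i : gi g1 (minterm f) (literal (i, f i)).
Proof.
apply: gi_taut => a; rewrite /minterm /literals.
have := mem_enum 'I_N i; rewrite [i \in 'I_N]/= => h.
have {h} : i \in enum 'I_N by rewrite h.
elim: (enum _) => [//|j l IHl]; rewrite inE map_cons beval_conjs.
by case/predU1P=> [->|/IHl{}IHl] /andP[].
Qed.

(* Decide the variables one by one, using [phi = (phi && p) || (phi && ~~ p)]. *)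
Lemma prime_minterm (P : bexp N -> Prop) :
  (forall phi psi, gi g1 phi psi -> P phi -> P psi) ->
  (forall phi psi, P (BOr phi psi) -> P phi \/ P psi) ->
  forall phi, P phi -> exists f, P (BAnd phi (minterm f)).
Proof.
move=> Pmono Pprime phi Pphi.
suff h l : uniq l -> forall phi, P phi ->
    exists f : {ffun 'I_N -> bool}, P (BAnd phi (conjs (literals f l))).
  by apply: h Pphi; apply: enum_uniq.
elim: l {phi Pphi} => [_|i l IHl /andP[il /IHl{}IHl]] phi Pphi.
  by exists [ffun=> true]; apply: Pmono Pphi; apply: gi_taut => a /= ->.
have [b /IHl[f Pf]] : exists b, P (BAnd phi (literal (i, b))).
  have : P (BOr (BAnd phi (literal (i, true))) (BAnd phi (literal (i, false)))).
    by apply: Pmono Pphi; apply: gi_taut => a /= ->; apply: orbN.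
  by case/Pprime; [exists true | exists false].
exists [ffun j => if j == i then b else f j]; apply: Pmono Pf; apply: gi_taut => a.
rewrite /literals map_cons ffunE eqxx; set c := conjs (_ :: _).
rewrite /= {}/c beval_conjs -andbA.
case/and3P=> -> -> /=; congr (beval a (conjs _)); apply/eq_in_map => j jl.
by rewrite ffunE; case: eqP jl il => // -> ->.
Qed.

(** Indexing by truth assignments picks one m.e.c. among its reorderings and rebracketings, and
    makes the type finite. *)
Definition world : finType := {f : {ffun 'I_N -> bool} | ~~ gi g1 (minterm f) BBot}.
Definition at_world (w : world) : bexp N := minterm (val w).
Definition canon_eval phi : {set world} := [set w | gi g1 (at_world w) phi].

Lemma at_world_mec w : mec (at_world w).
Proof. exact: minterm_mec. Qed.

Lemma at_world_nbot c w : ~~ gi c (at_world w) BBot.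
Proof. by apply: contra (valP w); apply: gi_bot. Qed.

Lemma gi_refl phi : gi g1 phi phi.
Proof. exact: gi_taut. Qed.

Lemma canon_neg w phi : gi g1 (at_world w) (BNeg phi) = ~~ gi g1 (at_world w) phi.
Proof.
apply/idP/idP => h.
  by apply/negP => h'; case/negP: (at_world_nbot g1 w); apply: gi_contra h' h.
have := @gi_mec_or g1 _ phi (BNeg phi) (at_world_mec w); rewrite (negbTE h).
by apply; apply: gi_taut => a _; apply: orbN.
Qed.

Lemma canon_or w phi psi :
  gi g1 (at_world w) (BOr phi psi)
  = gi g1 (at_world w) phi || gi g1 (at_world w) psi.
Proof.
apply/idP/idP => [|/orP[] h]; first exact: gi_mec_or (at_world_mec w).
  by apply: gi_transr h _; apply: gi_taut => a /= ->.
by apply: gi_transr h _; apply: gi_taut => a /= ->; apply: orbT.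
Qed.

Lemma canon_and w phi psi :
  gi g1 (at_world w) (BAnd phi psi)
  = gi g1 (at_world w) phi && gi g1 (at_world w) psi.
Proof.
have e chi chi' : (forall a, beval a chi = beval a chi') ->
    gi g1 (at_world w) chi = gi g1 (at_world w) chi'.
  by move=> h; apply/idP/idP => /gi_transr; apply; apply: gi_taut => a; rewrite h.
(* De Morgan reduces conjunction to the connectives already decided at worlds. *)
rewrite (e _ (BNeg (BOr (BNeg phi) (BNeg psi)))) => [|a /=].
  by rewrite canon_neg canon_or !canon_neg negb_or !negbK.
by rewrite negb_or !negbK.
Qed.

(* Used with [P chi] being [eps =>[c] chi], [~ (chi =>[c] psi)],
   [eps =>[1] DiaLe chi] and [eps =>[1] DiaGe chi], to descend from [chi] to a
   single world. *)
Lemma prime_world (P : bexp N -> Prop) :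
  (forall phi psi, gi g1 phi psi -> P phi -> P psi) ->
  (forall phi psi, P (BOr phi psi) -> P phi \/ P psi) ->
  ~ P BBot ->
  forall phi, P phi -> exists2 w, w \in canon_eval phi & P (at_world w).
Proof.
move=> Pmono Pprime Pbot phi /(prime_minterm Pmono Pprime)[f Pf].
have wf : ~~ gi g1 (minterm f) BBot.
  apply: contra_notN Pbot => h; apply: Pmono Pf; apply: gi_transl h.
  by apply: gi_taut => a /= /andP[].
exists (Sub f wf); last first.
  by apply: Pmono Pf; apply: gi_taut => a /= /andP[].
rewrite inE; apply: contra_notT Pbot; rewrite -canon_neg => h.
apply: Pmono Pf; apply: (@gi_contra _ phi); first by apply: gi_taut => a /= /andP[].
by apply: gi_transl h; apply: gi_taut => a /= /andP[].
Qed.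

(** Canonical counterpart of the neighbourhood operator: by A8, implication from a world at grade
    [c] is prime on the right. *)
Lemma canon_world c w phi :
  gi c (at_world w) phi <->
  exists2 u, u \in canon_eval phi & gi c (at_world w) (at_world u).
Proof.
split=> [|[u]]; last by rewrite inE => h1 h2; apply: gi_transr h1.
apply: (@prime_world (gi c (at_world w))) => [chi psi h h'|chi psi|].
- exact: gi_transr h.
- by move/(gi_mec_or (at_world_mec w))/orP.
- exact/negP/at_world_nbot.
Qed.

(** By A7, failing to imply [psi] at grade [c] is prime, so a failure at [phi] is inherited by some
    world in it. *)
Lemma canon_gi c phi psi :
  gi c phi psi <->
  forall w, w \in canon_eval phi -> gi c (at_world w) psi.
Proof.
split=> [h w|h]; first by rewrite inE => /gi_transl; apply.
apply/negPn/negP => n.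
suff [w /h ->] : exists2 w, w \in canon_eval phi & ~~ gi c (at_world w) psi.
  by [].
apply: (@prime_world (fun chi => ~~ gi c chi psi)) n.
- by move=> chi chi' hc; apply: contra; apply: gi_transl.
- move=> chi chi'; case: (boolP (gi c chi psi)) => h1; last by left.
  by move=> h2; right; apply: contra h2; apply: gi_orl.
- by apply/negP/negPn; apply: (gi_le (le_g1 c)); apply: gi_taut.
Qed.

(** If the two worlds differed at a variable, [at_world u] would imply both of its literals. *)
Lemma at_world_eq u w : gi g1 (at_world u) (at_world w) -> u = w.
Proof.
move=> h; apply/val_inj/ffunP => i.
have h1 : gi g1 (at_world u) (literal (i, val w i)).
  by apply: gi_transr h _; apply: minterm_literal.
have := minterm_literal (val u) i; move: h1; rewrite /literal /=.
by case: (val u i); case: (val w i) => //; rewrite -/(at_world u) canon_neg => h1 h2;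
  [rewrite h2 in h1 | rewrite h1 in h2].
Qed.

(** * Canonical order and the truth of diamonds *)

Definition canon_le : rel world := fun u w => gi g1 (at_world u) (DiaLe (at_world w)).

Lemma dia_mono phi psi : gi g1 phi psi ->
  gi g1 (DiaLe phi) (DiaLe psi) /\ gi g1 (DiaGe phi) (DiaGe psi).
Proof. by move=> h; split; [apply: (v_imp (A17le _ _ _)) | apply: (v_imp (A17ge _ _ _))]. Qed.

(* A18 makes the two diamonds adjoint; on m.e.c.s this says that they describe
   the same order, read in opposite directions. *)
Lemma canon_dual u w : canon_le u w = gi g1 (at_world w) (DiaGe (at_world u)).
Proof.
apply/idP/idP => [|h].
  apply: contraLR; rewrite -canon_neg /canon_le -canon_neg => h.
  have /(v_imp (A18ge _ _ _)) : gi g1 (BAnd (at_world w) (DiaGe (at_world u))) BBot.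
    apply: (@gi_contra _ (DiaGe (at_world u))); first by apply: gi_taut => a /= /andP[].
    by apply: gi_transl h; apply: gi_taut => a /= /andP[].
  move=> /= {}h; rewrite canon_neg; apply/negP => h'; case/negP: (at_world_nbot g1 u).
  apply: gi_transr h; rewrite canon_and h' /=; exact/gi_axiom/A12ge.
move: h; apply: contraLR; rewrite -canon_neg /canon_le -canon_neg => h.
have /(v_imp (A18le _ _ _)) : gi g1 (BAnd (at_world u) (DiaLe (at_world w))) BBot.
  apply: (@gi_contra _ (DiaLe (at_world w))); first by apply: gi_taut => a /= /andP[].
  by apply: gi_transl h; apply: gi_taut => a /= /andP[].
move=> /= {}h; rewrite canon_neg; apply/negP => h'; case/negP: (at_world_nbot g1 w).
apply: gi_transr h; rewrite canon_and h' /=; exact/gi_axiom/A12le.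
Qed.

(** No axiom distributes diamonds over disjunction. By A15 one of the two diamonds implies the
    other; A12, A17 and A13 then let the larger one absorb the diamond of the disjunction. *)
Lemma gi_diale_or phi psi w : gi g1 (at_world w) (DiaLe (BOr phi psi)) ->
  gi g1 (at_world w) (DiaLe phi) \/ gi g1 (at_world w) (DiaLe psi).
Proof.
have key chi chi' : gi g1 (DiaLe chi) (DiaLe chi') ->
    gi g1 (DiaLe (BOr chi chi')) (DiaLe chi').
  move=> h; have /dia_mono[+ _] : gi g1 (BOr chi chi') (DiaLe chi').
    by apply: gi_orl; [apply: gi_transl h|]; apply/gi_axiom/A12le.
  by move/gi_transr; apply; apply/gi_axiom/A13le.
move=> h; have /orP[hl|hl] := v_axiom (A15le V phi psi).
  by right; apply: gi_transr h (key _ _ hl).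
left; apply: gi_transr (key _ _ hl); apply: gi_transr h _.
by have [] // := @dia_mono (BOr phi psi) (BOr psi phi); apply: gi_taut => a /=; rewrite orbC.
Qed.

Lemma gi_diage_or phi psi w : gi g1 (at_world w) (DiaGe (BOr phi psi)) ->
  gi g1 (at_world w) (DiaGe phi) \/ gi g1 (at_world w) (DiaGe psi).
Proof.
have key chi chi' : gi g1 (DiaGe chi) (DiaGe chi') ->
    gi g1 (DiaGe (BOr chi chi')) (DiaGe chi').
  move=> h; have /dia_mono[_ +] : gi g1 (BOr chi chi') (DiaGe chi').
    by apply: gi_orl; [apply: gi_transl h|]; apply/gi_axiom/A12ge.
  by move/gi_transr; apply; apply/gi_axiom/A13ge.
move=> h; have /orP[hl|hl] := v_axiom (A15ge V phi psi).
  by right; apply: gi_transr h (key _ _ hl).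
left; apply: gi_transr (key _ _ hl); apply: gi_transr h _.
by have [] // := @dia_mono (BOr phi psi) (BOr psi phi); apply: gi_taut => a /=; rewrite orbC.
Qed.

Lemma canon_diale w phi : gi g1 (at_world w) (DiaLe phi) <->
  exists2 u, u \in canon_eval phi & canon_le w u.
Proof.
split=> [|[u]]; last by rewrite inE => /dia_mono[h _] h'; apply: gi_transr h.
apply: (@prime_world (fun chi => gi g1 (at_world w) (DiaLe chi))).
- by move=> chi psi /dia_mono[h _] h'; apply: gi_transr h.
- by move=> chi psi; apply: gi_diale_or.
- move=> h; case/negP: (at_world_nbot g1 w); apply: gi_transr h _; exact/gi_axiom/A14le.
Qed.

Lemma canon_diage w phi : gi g1 (at_world w) (DiaGe phi) <->
  exists2 u, u \in canon_eval phi & canon_le u w.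
Proof.
split=> [h|[u]]; last first.
  by rewrite inE canon_dual => /dia_mono[_ h] h'; apply: gi_transr h.
suff [u hu h'] : exists2 u, u \in canon_eval phi & gi g1 (at_world w) (DiaGe (at_world u)).
  by exists u; rewrite ?canon_dual.
apply: (@prime_world (fun chi => gi g1 (at_world w) (DiaGe chi))) h.
- by move=> chi psi /dia_mono[_ h] h'; apply: gi_transr h.
- by move=> chi psi; apply: gi_diage_or.
- move=> h; case/negP: (at_world_nbot g1 w); apply: gi_transr h _; exact/gi_axiom/A14ge.
Qed.

Lemma canon_evaluation : evaluation canon_le canon_eval.
Proof.
split.
- by move=> phi psi; apply/setP => w; rewrite !inE canon_and.
- by move=> phi psi; apply/setP => w; rewrite !inE canon_or.
- by move=> phi; apply/setP => w; rewrite !inE canon_neg.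
- by apply/setP => w; rewrite !inE; apply/negbTE/at_world_nbot.
- by apply/setP => w; rewrite !inE; apply: gi_taut.
- move=> phi; apply/setP => w; rewrite [LHS]inE.
  by apply/idP/down_setP => /canon_diale.
- move=> phi; apply/setP => w; rewrite [LHS]inE.
  by apply/idP/up_setP => /canon_diage.
- have mem_var (w : world) i : (w \in canon_eval (BVar i)) = val w i.
    have := minterm_literal (val w) i; rewrite inE /literal /=.
    by case: (val w i) => //; rewrite -/(at_world w) canon_neg => /negbTE.
  move=> u w uw; apply/existsP; apply: contraNT uw; rewrite negb_exists => /forallP h.
  by apply/eqP/val_inj/ffunP => i; apply/eqP; have := h i; rewrite negbK !mem_var.
Qed.

(** * Canonical similarity and the truth lemma *)

Definition canon_sim (u w : world) : grade V :=
  [arg max_(c > g0 | gi c (at_world u) (at_world w)) val c]%O.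

(** A4 makes [g0] admissible, so the maximum exists; A3 closes the admissible grades downwards, so
    they are those below it. *)
Lemma gle_canon_sim c u w : gle c (canon_sim u w) = gi c (at_world u) (at_world w).
Proof.
rewrite /canon_sim; case: Order.TotalTheory.arg_maxP => [|d hd dmax].
  apply: (v_imp (A4 _ _ _)); exact: at_world_nbot.
by apply/idP/idP => [/gi_le|/dmax]; [apply|].
Qed.

Lemma canon_sim_ext c d : (forall b, gle b c = gle b d) -> c = d.
Proof. by move=> h; apply: gle_anti; [rewrite -h | rewrite h]; apply: gle_refl. Qed.

Lemma canon_simC u w : canon_sim u w = canon_sim w u.
Proof.
have h u' w' c : gi c (at_world u') (at_world w') -> gi c (at_world w') (at_world u').
  apply: (v_imp2 (A6 _ (at_world_mec u') (at_world_mec w'))).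
  exact: at_world_nbot.
by apply: canon_sim_ext => c; rewrite !gle_canon_sim; apply/idP/idP; apply: h.
Qed.

(** Through [u] and [z], the world [x] implies both diamonds of [w] at grade [c]. They are jointly
    consistent because [w] satisfies them. Taking for [x] the ends [u] and [z] gives the two halves
    of compatibility. *)
Lemma canon_between c x u w z : canon_le u w -> canon_le w z ->
  gi c (at_world x) (at_world u) -> gi c (at_world x) (at_world z) ->
  gi c (at_world x) (at_world w).
Proof.
rewrite (canon_dual w) => uw wz xu xz.
have dia phi : is_diamond phi -> diamond_conj phi.
  by move=> h; exists [:: phi]; split; rewrite //= ?h //; apply: conj_one.
apply: gi_transr (v_axiom (A16 V (at_world_mec w))).
apply: (v_imp2 (A19 _ _ (dia (DiaLe _) isT) (dia (DiaGe _) isT))); last first.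
  exact: (gi_transr xz wz).
apply/andP; split; last exact: (gi_transr xu uw).
apply/negP => h; case/negP: (at_world_nbot g1 w); apply: gi_transr h.
by rewrite canon_and; apply/andP; split; apply/gi_axiom; [apply: A12le | apply: A12ge].
Qed.

Lemma canon_space : to_similarity_space canon_sim canon_le.
Proof.
split; first split.
(* A world exists: top does not imply bottom by A10, and this failure is prime by A7. *)
- suff [w _ _] : exists2 w, w \in canon_eval BTop & ~~ gi g1 (at_world w) BBot.
    exact: (inhabits w).
  apply: (@prime_world (fun phi => ~~ gi g1 phi BBot)) (v_axiom (A10 V N)).
  + by move=> phi psi h; apply: contra; apply: gi_transl.
  + move=> phi psi; case: (boolP (gi g1 phi BBot)) => h1; last by left.
    by move=> h2; right; apply: contra h2; apply: gi_orl.
  + by rewrite gi_refl.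
- move=> u w; split=> [h|->].
    by apply: at_world_eq; rewrite -gle_canon_sim h gle_refl.
  by apply: gle_anti; [apply: le_g1 | rewrite gle_canon_sim gi_refl].
- exact: canon_simC.
- move=> u w z; rewrite gle_canon_sim.
  by apply: (@gi_trans _ _ _ (at_world w)); rewrite -gle_canon_sim gle_refl.
- by move=> w; apply/gi_axiom/A12le.
(* By duality [u] implies both diamonds of [w], hence [w] itself by A16. *)
- move=> u w /andP[uw]; rewrite canon_dual => wu; apply: at_world_eq.
  apply: gi_transr (v_axiom (A16 V (at_world_mec w))).
  by rewrite canon_and; apply/andP.
- rewrite /canon_le => w u z uw /dia_mono[h _]; apply: gi_transr uw _.
  by apply: gi_transr h _; apply/gi_axiom/A13le.
- move=> u w; have /orP[h|h] := v_axiom (A15le V (at_world u) (at_world w)).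
    by apply/orP; left; apply: gi_transl h; apply/gi_axiom/A12le.
  by apply/orP; right; apply: gi_transl h; apply/gi_axiom/A12le.
- have refl c u : gi c (at_world u) (at_world u).
    exact: gi_le (le_g1 c) (gi_refl _).
  move=> u w z uw wz; apply/andP; split.
    by rewrite gle_canon_sim; apply: canon_between uw wz _ _ => //;
      rewrite -gle_canon_sim gle_refl.
  rewrite (canon_simC w) gle_canon_sim; apply: canon_between uw wz _ _ => //.
  by rewrite -gle_canon_sim canon_simC gle_refl.
Qed.

(** On graded implications, [canon_gi] reduces the left side to worlds and [canon_world] the right
    side. *)
Lemma sat_canon X : sat canon_sim canon_eval X = ceval v X.
Proof.
rewrite /sat; elim: X => /= [[phi c psi]|A -> B ->|A -> B ->|A ->] //=.
apply/subsetP/idP => [h|/canon_gi h w /h /canon_world[u uA wu]].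
  apply/canon_gi => w /h; rewrite inE => /exists_inP[u uA].
  by rewrite gle_canon_sim => wu; apply/canon_world; exists u.
by rewrite inE; apply/exists_inP; exists u; rewrite ?gle_canon_sim.
Qed.

End CanonicalModel.

Theorem theorem3p7 (R : realType) (V : grading R) (N : nat)
    (T : formula V N -> Prop) (Phi : formula V N) :
  derivable T Phi <-> entails T Phi.
Proof.
split=> [|ent]; first exact: derivable_entails.
(* Were [Phi] underivable, the canonical model would satisfy [T] and refute [Phi]. *)
apply: boolp.contrapT => /valuation_of_underivable[v [vT vax /negP]]; apply.
rewrite -(sat_canon vax); apply: ent (canon_space vax) _ (canon_evaluation vax) _.
by move=> Psi /vT; rewrite sat_canon.
Qed.
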